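(* (a) There is an absolute constant $K>0$ such that for all integers $d\ge 1$, $k\ge 2$ and every POVM $\mathbf{M}=(M_1,\dots,M_n)$ on $\mathbb{C}^d$, there exist a probability distribution $\{p_\beta\}$ and POVMs $\mathbf{N}^{(\beta)}$ on $\mathbb{C}^d$ with outcome set $[n]\cup\{\emptyset\}$ such that each $\mathbf{N}^{(\beta)}$ is implementable with a $k$-dimensional ancilla, and $\sum_\beta p_\beta \mathbf{N}^{(\beta)}=(q_k\mathbf{M},(1-q_k)\mathbb{I}_d)$ for some $q_k\ge 1-K k^{-1/2}$. (b) For $k=2$ one can moreover achieve $q_2\ge 1/8$ with each $\mathbf{N}^{(\beta)}$ implementable with a $2$-dimensional ancilla (a single qubit) and having at most $d+1$ nonzero effects.
   Context: A POVM on $\mathbb{C}^d$ with $n$ outcomes is a tuple $(M_1,\dots,M_n)$ of positive semidefinite operators summing to $\mathbb{I}_d$; it is projective if its effects satisfy $M_iM_j=\delta_{ij}M_i$. A classical post-processing is given by numbers $q_{i|j}\ge0$ with $\sum_i q_{i|j}=1$, mapping effects $M_j$ to $\sum_j q_{i|j}M_j$. Convex combinations of POVMs are taken effect-wise. The notation $(q\mathbf{M},(1-q)\mathbb{I}_d)$ denotes the POVM with outcome set $[n]\cup\{\emptyset\}$ and effects $qM_i$ for $i\in[n]$ and $(1-q)\mathbb{I}_d$ for $\emptyset$ (i.e., simulation of $\mathbf{M}$ with postselection probability $q$). A POVM $\mathbf{N}$ on $\mathbb{C}^d$ is implementable with a $k$-dimensional ancilla if there exist a unit vector $\ket{\phi_0}\in\mathbb{C}^k$,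 a projective measurement $(P_1,\dots,P_m)$ on $\mathbb{C}^d\otimes\mathbb{C}^k$ and a classical post-processing $q_{i|j}$ such that $N_i=\sum_j q_{i|j}(\mathbb{I}_d\otimes\bra{\phi_0})P_j(\mathbb{I}_d\otimes\ket{\phi_0})$ for all outcomes $i$. *)

(* Defs.v *)
From HB Require Import structures.
From mathcomp Require Import all_boot all_order all_algebra.
From mathcomp Require Import complex mxtens.
From mathcomp Require Import reals.

Set Implicit Arguments.
Unset Strict Implicit.
Unset Printing Implicit Defensive.

Import Order.TTheory GRing.Theory Num.Theory.
Local Open Scope ring_scope.
Local Open Scope complex_scope.

Section QDefs.
Variable R : rcfType.
Local Notation C := (R[i]).

Definition mxadj (m n : nat) (A : 'M[C]_(m, n)) : 'M[C]_(n, m) :=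
  (map_mx Num.conj A)^T.

Definition psd (d : nat) (A : 'M[C]_d) : Prop :=
  mxadj A = A /\ forall v : 'cV[C]_d, 0 <= (mxadj v *m A *m v) 0 0.

Definition is_POVM (d : nat) (I : finType) (M : I -> 'M[C]_d) : Prop :=
  (forall i, psd (M i)) /\ \sum_(i : I) M i = 1%:M.

Definition is_projective (d : nat) (I : finType) (M : I -> 'M[C]_d) : Prop :=
  is_POVM M /\ forall i j, M i *m M j = if i == j then M i else 0.

Definition is_postprocessing (I J : finType) (q : I -> J -> R) : Prop :=
  (forall i j, 0 <= q i j) /\ forall j, \sum_(i : I) q i j = 1.

Definition is_prob (B : finType) (p : B -> R) : Prop :=
  (forall b, 0 <= p b) /\ \sum_(b : B) p b = 1.

(* the map |psi> |-> |psi> (x) |phi0>, as a (d*k) x d matrix: I_d (x) |phi0> *)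
Definition ancilla_embed (d k : nat) (phi : 'cV[C]_k) : 'M[C]_(d * k, d) :=
  castmx (erefl (d * k)%N, muln1 d) ((1%:M : 'M[C]_d) *t phi).

Definition implementable (k d : nat) (I : finType) (N : I -> 'M[C]_d) : Prop :=
  exists phi : 'cV[C]_k, (mxadj phi *m phi) 0 0 = 1 /\
  exists (m : nat) (P : 'I_m -> 'M[C]_(d * k)) (q : I -> 'I_m -> R),
    is_projective P /\ is_postprocessing q /\
    forall i, N i = \sum_(j < m) (q i j)%:C *:
                 (mxadj (ancilla_embed d phi) *m P j *m ancilla_embed d phi).

(* sum_beta p_beta N^(beta) = (q M, (1-q) I_d), each N^(beta) a POVM with
   outcome set [n] u {empty} (= option 'I_n, None = empty) implementable with
   a k-dimensional ancilla *)
Definition convex_ancilla_simulation (d n k : nat) (M : 'I_n -> 'M[C]_d)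
  (B : finType) (p : B -> R) (N : B -> option 'I_n -> 'M[C]_d) (q : R) : Prop :=
  is_prob p /\
  (forall b, is_POVM (N b) /\ implementable k (N b)) /\
  (forall i : 'I_n, \sum_(b : B) (p b)%:C *: N b (Some i) = q%:C *: M i) /\
  \sum_(b : B) (p b)%:C *: N b None = (1 - q)%:C *: 1%:M.

End QDefs.

(* Main.v *)
Require Import Defs.
From HB Require Import structures.
From mathcomp Require Import all_boot all_order all_algebra.
From mathcomp Require Import complex mxtens ring lra.
From mathcomp Require Import reals.
Import Order.TTheory GRing.Theory Num.Theory.
Local Open Scope ring_scope.
Local Open Scope complex_scope.

(**
Refine the POVM to rank-one effects [v_j v_j^*] summing to the identity. Call
a weight vector [w >= 0] admissible if it is supported on at most [d (k - 1)]
indices and [sum_j w_j v_j v_j^* <= 1]. Completing such a family with the at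
most [d] rank-one pieces of the defect, which are reported as the failure
outcome, gives at most [d k] rank-one effects; by Naimark's theorem this POVM
is implementable with a [k]-dimensional ancilla. It remains to write the
constant vector [q] as an average of admissible weights.

By a minimax argument it suffices to find, for each [y >= 0], an admissible [w]
with [sum_j y_j w_j >= q sum_j y_j]. The one-sided barrier argument of Batson,
Spielman and Srivastava does this with [q = m / (1 + sqrt m)^2], [m = k - 1]:
starting from the scalar barrier [u = d sqrt m], raise [u] by [1] in each of
[d m] steps and add a rank-one term that keeps the trace of [(u - A)^-1] from
growing; averaging over [j] finds a term whose gain in [y] is large. This
yields [1/4] for [k = 2] and [1 - O(k^(-1/2))] in general. The minimax step is
Blackwell's approachability argument: finitely many rounds make the average at
least any [q' < q] in each coordinate, and shrinking weights makes it exactly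
[q'].
*)

Set Implicit Arguments.
Unset Strict Implicit.
Unset Printing Implicit Defensive.

Local Notation "A ^h" := (mxadj A) (at level 8, format "A ^h").

(** * Positive definite matrices *)

Section Adjoint.
Variable R : rcfType.
Local Notation C := (R[i]).

Lemma mxadjE m n (A : 'M[C]_(m, n)) i j : A^h i j = (A j i)^*%R.
Proof. by rewrite !mxE. Qed.

Lemma mxadjK m n (A : 'M[C]_(m, n)) : A^h^h = A.
Proof. by apply/matrixP => i j; rewrite !mxadjE conjCK. Qed.

Lemma mxadjD m n (A B : 'M[C]_(m, n)) : (A + B)^h = A^h + B^h.
Proof. by rewrite /mxadj map_mxD linearD. Qed.

Lemma mxadjZ m n a (A : 'M[C]_(m, n)) : (a *: A)^h = a^*%R *: A^h.
Proof. by rewrite /mxadj map_mxZ linearZ. Qed.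

Lemma mxadjZr m n (a : R) (A : 'M[C]_(m, n)) : (a%:C *: A)^h = a%:C *: A^h.
Proof.
by rewrite mxadjZ (CrealP _) //; apply/complex_realP; exists a.
Qed.

Lemma mxadjM m n p (A : 'M[C]_(m, n)) (B : 'M_(n, p)) :
  (A *m B)^h = B^h *m A^h.
Proof. by rewrite /mxadj map_mxM trmx_mul. Qed.

Lemma mxadj0 m n : (0 : 'M[C]_(m, n))^h = 0.
Proof. by rewrite /mxadj map_mx0 trmx0. Qed.

Lemma mxadj1 n : (1%:M : 'M[C]_n)^h = 1%:M.
Proof. by rewrite /mxadj map_mx1 trmx1. Qed.

Lemma mxtrace_rank1 n (A : 'M[C]_n) (v : 'cV[C]_n) :
  \tr (A *m (v *m v^h)) = (v^h *m A *m v) 0 0.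
Proof. by rewrite mulmxA mxtrace_mulC mulmxA /mxtrace big_ord1. Qed.

Lemma psd0 n : psd (0 : 'M[C]_n).
Proof. by split=> [|v]; rewrite ?mxadj0 ?mulmx0 ?mul0mx ?mxE. Qed.

Lemma psdD n (A B : 'M[C]_n) : psd A -> psd B -> psd (A + B).
Proof.
move=> [hA pA] [hB pB]; split=> [|v]; first by rewrite mxadjD hA hB.
by rewrite mulmxDr mulmxDl mxE addr_ge0.
Qed.

Lemma psdZ n (a : C) (A : 'M[C]_n) : 0 <= a -> psd A -> psd (a *: A).
Proof.
move=> a0 [hA pA]; split=> [|v].
  by rewrite mxadjZ hA (CrealP _) ?ger0_real.
by rewrite -scalemxAr -scalemxAl mxE mulr_ge0.
Qed.

Lemma psd_sum n (I : Type) (r : seq I) (P : pred I) (F : I -> 'M[C]_n) :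
  (forall i, P i -> psd (F i)) -> psd (\sum_(i <- r | P i) F i).
Proof. by move=> F_psd; elim/big_ind: _ => //; [exact: psd0|exact: psdD]. Qed.

Lemma psd_conj m n (A : 'M[C]_n) (B : 'M[C]_(n, m)) :
  psd A -> psd (B^h *m A *m B).
Proof.
move=> [hA pA]; split=> [|v]; first by rewrite !mxadjM mxadjK hA !mulmxA.
by have := pA (B *m v); rewrite mxadjM !mulmxA.
Qed.

Lemma mxadj_self_gt0 n (v : 'cV[C]_n) : v != 0 -> 0 < (v^h *m v) 0 0.
Proof.
move=> v0; rewrite mxE.
have /existsP[i vi] : [exists i, v i 0 != 0].
  apply: contraNT v0; rewrite negb_exists => /forallP vN.
  by apply/eqP/colP => j; rewrite mxE; apply/eqP; rewrite -[_ == _]negbK vN.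
rewrite (bigD1 i) //= ltr_wpDr ?sumr_ge0 ?mxadjE ?[_^* * _]mulrC
  ?mul_conjC_gt0//.
by move=> j _; rewrite mxadjE mulrC mul_conjC_ge0.
Qed.

Lemma psd1 n : psd (1%:M : 'M[C]_n).
Proof.
split=> [|v]; first exact: mxadj1.
rewrite mulmx1; have [->|/mxadj_self_gt0/ltW //] := eqVneq v 0.
by rewrite mulmx0 mxE.
Qed.

Lemma psd_rank1 n (v : 'cV[C]_n) : psd (v *m v^h).
Proof. by have := psd_conj v^h (psd1 1); rewrite mulmx1 mxadjK. Qed.

Lemma mx_diag_form n (A : 'M[C]_n) i :
  ((delta_mx i 0 : 'cV[C]_n)^h *m A *m (delta_mx i 0 : 'cV[C]_n)) 0 0 = A i i.
Proof.
by rewrite /mxadj map_delta_mx trmx_delta -rowE -colE !mxE.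
Qed.

Lemma psd_trace_ge0 n (A : 'M[C]_n) : psd A -> 0 <= \tr A.
Proof. by move=> [_ pA]; apply: sumr_ge0 => i _; rewrite -mx_diag_form. Qed.

Lemma ge0_ReK (x : C) : 0 <= x -> (complex.Re x)%:C = x.
Proof. by move=> /ger0_real/RRe_real. Qed.

Definition pd n (A : 'M[C]_n) : Prop :=
  A^h = A /\ forall v : 'cV[C]_n, v != 0 -> 0 < (v^h *m A *m v) 0 0.

Lemma pd_psd n (A : 'M[C]_n) : pd A -> psd A.
Proof.
move=> [hA pA]; split=> // v; have [->|/pA/ltW //] := eqVneq v 0.
by rewrite mulmx0 mxE.
Qed.

Lemma pdD n (A B : 'M[C]_n) : pd A -> psd B -> pd (A + B).
Proof.
move=> [hA pA] [hB pB]; split=> [|v v0]; first by rewrite mxadjD hA hB.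
by rewrite mulmxDr mulmxDl mxE ltr_wpDr ?pA.
Qed.

Lemma pd_scalar n (a : R) : 0 < a -> pd (a%:C%:M : 'M[C]_n).
Proof.
move=> a0; rewrite -scalemx1; split=> [|v v0]; first by rewrite mxadjZr mxadj1.
by rewrite -scalemxAr mulmx1 -scalemxAl mxE mulr_gt0 ?ltcR ?mxadj_self_gt0.
Qed.

Lemma pd_unit n (A : 'M[C]_n) : pd A -> A \in unitmx.
Proof.
move=> [hA pA]; rewrite unitmxE unitfE; apply/negP => /det0P[v v0 vA].
have : v^h != 0 by apply: contraNneq v0 => /(congr1 (@mxadj _ _ _));
  rewrite mxadjK mxadj0 => ->.
by move/pA; rewrite mxadjK vA mul0mx mxE ltxx.
Qed.

Lemma mxadj_inv n (A : 'M[C]_n) : A \in unitmx -> (invmx A)^h = invmx A^h.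
Proof.
move=> uA; have : (invmx A)^h *m A^h = 1%:M by rewrite -mxadjM mulmxV ?mxadj1.
move=> h; have [_ uB] := mulmx1_unit h.
by rewrite -[LHS]mulmx1 -(mulmxV uB) mulmxA h mul1mx.
Qed.

Lemma pd_inv n (A : 'M[C]_n) : pd A -> pd (invmx A).
Proof.
move=> Apd; have uA := pd_unit Apd; case: (Apd) => hA pA.
split=> [|v v0]; first by rewrite mxadj_inv ?hA.
have := pA (invmx A *m v); rewrite mxadjM mxadj_inv // hA.
rewrite -!mulmxA (mulmxA A) mulmxV // mul1mx; apply.
by apply: contraNneq v0 => /(congr1 (mulmx A));
  rewrite mulmxA mulmxV // mul1mx mulmx0 => ->.
Qed.

Lemma pd_trace_gt0 n (A : 'M[C]_n) : (0 < n)%N -> pd A -> 0 < \tr A.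
Proof.
case: n A => // n A _ [_ pA].
suff diag i : 0 < A i i.
  by rewrite /mxtrace big_ord_recl ltr_wpDr ?sumr_ge0 // => i _; exact: ltW.
rewrite -mx_diag_form; apply: pA; apply/eqP => /matrixP/(_ i 0).
by rewrite !mxE !eqxx /= => /eqP; rewrite oner_eq0.
Qed.

Lemma pd_sqr n (A : 'M[C]_n) : pd A -> pd (A *m A).
Proof.
move=> Apd; have uA := pd_unit Apd; case: (Apd) => hA pA.
split=> [|v v0]; first by rewrite mxadjM hA.
have := @mxadj_self_gt0 _ (A *m v); rewrite mxadjM hA !mulmxA; apply.
by apply: contraNneq v0 => /(congr1 (mulmx (invmx A)));
  rewrite mulKmx // mulmx0 => ->.
Qed.

End Adjoint.

(** * The one-sided barrier argument *)

Section Barrier.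
Variable R : rcfType.
Local Notation C := (R[i]).

(** Raising the barrier by one lowers the potential: the resolvent identities [y = x + y x] and
    [y = x + x y] combine into [y = x + x^2 + x y x], and [x y x] is positive semidefinite. *)
Lemma mxtrace_inv_shift n (Y : 'M[C]_n) : pd Y ->
  let x := invmx (Y + 1%:M) in \tr x + \tr (x *m x) <= \tr (invmx Y).
Proof.
move=> Ypd /=; set x := invmx (Y + _); set y := invmx Y.
have Xpd : pd (Y + 1%:M) by apply: pdD => //; exact: psd1.
have uY := pd_unit Ypd; have uX := pd_unit Xpd.
have y1 : y = x + y *m x.
  by rewrite -[LHS](mulmxK uX) mulmxDr mulVmx // mulmx1 mulmxDl mul1mx.
have y2 : y = x + x *m y.
  by rewrite -[LHS](mulKmx uX) mulmxDl mulmxV // mul1mx mulmxDr mulmx1.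
have -> : y = x + (x *m x + x *m y *m x) by rewrite {1}y1 {1}y2 mulmxDl.
rewrite !raddfD /= addrA lerDl psd_trace_ge0 //.
have := psd_conj x (pd_psd (pd_inv Ypd)).
by rewrite (_ : x^h = x) //; have [] := pd_inv Xpd.
Qed.

Lemma rank1_mul_rank1 n (A : 'M[C]_n) (v : 'cV[C]_n) :
  v *m v^h *m A *m (v *m v^h) = (v^h *m A *m v) 0 0 *: (v *m v^h).
Proof.
rewrite -!mulmxA (mulmxA A) (mulmxA v^h) (mulmxA v^h A v).
rewrite [v^h *m A *m v]mx11_scalar -mulmxA mul_scalar_mx -scalemxAr.
by rewrite !mxE eqxx mulr1n.
Qed.

(** This is the coefficient of [x v v^*] left over when the Sherman-Morrison inverse is multiplied
    out in the next lemma but one identity matrix is set aside. *)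
Lemma sherman_morrison_coef (a b D : C) : 0 < b -> 0 < a -> 0 < D ->
  D / b - ((b / D + a)^-1 + D / b * ((b / D + a)^-1 * a)) = 0.
Proof.
move=> b0 a0 D0; have e0 : b + a * D != 0.
  by rewrite lt0r_neq0 ?addr_gt0 ?mulr_gt0.
by field; rewrite e0 !lt0r_neq0.
Qed.

(** By Sherman-Morrison, subtracting [t v v^*] raises the trace of the inverse by [t b / (1 - t a)],
    where [b = v^* x^2 v] and [a = v^* x v]. The weight [t = u^-1] makes this equal to [tr (x^2)],
    the drop guaranteed by the shift. *)
Lemma barrier_step n (Y : 'M[C]_n) (v : 'cV[C]_n) :
  (0 < n)%N -> pd Y -> v != 0 ->
  let x := invmx (Y + 1%:M) in
  let u := (v^h *m (x *m x) *m v) 0 0 / \tr (x *m x) + (v^h *m x *m v) 0 0 in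
  [/\ 0 < u, pd (Y + 1%:M - u^-1 *: (v *m v^h)) &
      \tr (invmx (Y + 1%:M - u^-1 *: (v *m v^h))) = \tr x + \tr (x *m x)].
Proof.
move=> n0 Ypd v0; set X := Y + 1%:M => x u.
have Xpd : pd X by apply: pdD => //; exact: psd1.
have xpd : pd x by exact: pd_inv.
have xxpd := pd_sqr xpd; have hx : x^h = x by case: xpd.
have uX := pd_unit Xpd.
have b0 : 0 < (v^h *m (x *m x) *m v) 0 0 by case: xxpd => _; apply.
have a0 : 0 < (v^h *m x *m v) 0 0 by case: xpd => _; apply.
have D0 : 0 < \tr (x *m x) by apply: pd_trace_gt0.
rewrite {}/u; move: b0 a0 D0.
set b := (X in X / _); set a := (X in _ + X); set D := \tr _ => b0 a0 D0.
have u0 : 0 < b / D + a by rewrite addr_gt0 ?divr_gt0.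
set Y' := X - _.
(* the Sherman-Morrison inverse of [Y'] *)
pose Z := x + (D / b) *: (x *m (v *m v^h) *m x).
have Zpd : pd Z.
  apply: pdD => //; apply: psdZ; first by rewrite ltW ?divr_gt0.
  by rewrite -[X in X *m _ *m x]hx; apply/psd_conj/psd_rank1.
have ZY : Z *m Y' = 1%:M.
  rewrite /Z /Y' mulmxBr !mulmxDl mulVmx // -!scalemxAl -!scalemxAr -!mulmxA.
  rewrite (mulmxA x) mulVmx // mulmx1 -addrA -[RHS]addr0; congr (_ + _).
  rewrite (mulmxA v) (mulmxA (v *m v^h)) rank1_mul_rank1 -/a -scalemxAr
    !scalerA.
  rewrite -[x *m v *m v^h]mulmxA -scalerDl -scalerBl.
  by rewrite sherman_morrison_coef ?scale0r.
have uZ := pd_unit Zpd.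
have -> : Y' = invmx Z by rewrite -[LHS](mulKmx uZ) ZY mulmx1.
split=> //; first exact: pd_inv.
rewrite invmxK raddfD /= linearZ /= mxtrace_mulC mulmxA mxtrace_rank1 -/b.
by rewrite divfK ?lt0r_neq0.
Qed.

(** If every index failed, summing the strict inequalities would contradict the bound on the sum of
    [r]; [j0] makes the sum nonempty, so that strictness survives. *)
Lemma weighted_pigeonhole (J : finType) (j0 : J) (r y : J -> R) (c : R) :
  (forall j, 0 <= y j) -> \sum_j r j <= c ->
  exists j, r j * (\sum_i y i) <= c * y j.
Proof.
move=> y0 rc; apply/existsP; apply: contraT; rewrite negb_exists => /forallP rN.
suff : c * (\sum_j y j) < c * (\sum_j y j) by rewrite ltxx.
apply: (@lt_le_trans _ _ ((\sum_j r j) * \sum_j y j)); last first.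
  by rewrite ler_wpM2r ?sumr_ge0.
rewrite mulr_sumr mulr_suml; apply: ltr_sum => [|j _].
  by apply/hasP; exists j0; rewrite ?mem_index_enum.
by rewrite ltNge rN.
Qed.

Section Frame.
Variables (d : nat) (J : finType) (v : J -> 'cV[C]_d).
Hypotheses (d_gt0 : (0 < d)%N) (v_neq0 : forall j, v j != 0).
Hypothesis (v_frame : \sum_j v j *m (v j)^h = 1%:M).

Lemma frame_trace (A : 'M[C]_d) : \sum_j ((v j)^h *m A *m v j) 0 0 = \tr A.
Proof.
rewrite -[in RHS](mulmx1 A) -v_frame mulmx_sumr raddf_sum /=.
by apply: eq_bigr => j _; rewrite mxtrace_rank1.
Qed.

Lemma frame_inhabited : exists j : J, true.
Proof.
case: (pickP (fun _ : J => true)) => [j _|J0]; first by exists j.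
have := v_frame; rewrite big_pred0 // => /matrixP/
  (_ (Ordinal d_gt0) (Ordinal d_gt0)).
by rewrite !mxE eqxx => /eqP; rewrite eq_sym oner_eq0.
Qed.

Lemma barrier_greedy_step (Y : 'M[C]_d) (y : J -> R) (phi : R) :
  pd Y -> \tr (invmx Y) <= phi%:C -> (forall j, 0 <= y j) ->
  exists (j : J) (t : R), [/\ 0 <= t,
    pd (Y + 1%:M - t%:C *: (v j *m (v j)^h)),
    \tr (invmx (Y + 1%:M - t%:C *: (v j *m (v j)^h))) <= phi%:C &
    \sum_i y i <= (1 + phi) * (y j * t)].
Proof.
move=> Ypd Yphi y0; have [j0 _] := frame_inhabited.
pose x := invmx (Y + 1%:M).
pose u j := ((v j)^h *m (x *m x) *m v j) 0 0 / \tr (x *m x) +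
  ((v j)^h *m x *m v j) 0 0.
have step j := barrier_step d_gt0 Ypd (v_neq0 j); rewrite -/x /= in step.
have shift := mxtrace_inv_shift Ypd; rewrite /= -/x in shift.
have xpd : pd x by apply/pd_inv/pdD => //; exact: psd1.
have D0 : 0 < \tr (x *m x) by apply/pd_trace_gt0/pd_sqr.
have u0 j : 0 < u j by case: (step j).
have uE j : (complex.Re (u j))%:C = u j by rewrite ge0_ReK ?ltW.
(* By [frame_trace] the first summands of [u] add up to 1 and the second ones to [tr x], which the
   shift bounds by [phi]. *)
have su : \sum_j complex.Re (u j) <= 1 + phi.
  rewrite -lecR raddf_sum /= (eq_bigr _ (fun j _ => uE j)) big_split /=.
  rewrite -mulr_suml !frame_trace divff ?lt0r_neq0 // rmorphD rmorph1 lerD2l.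
  by apply: le_trans Yphi; apply: le_trans shift; rewrite lerDl ltW.
have [j jP] := weighted_pigeonhole j0 y0 su.
have r0 : 0 < complex.Re (u j) by rewrite -ltcR uE.
exists j, (complex.Re (u j))^-1; have [_ Y'pd Y'tr] := step j.
have -> : (complex.Re (u j))^-1%:C = (u j)^-1 by rewrite -[in RHS]uE fmorphV.
split=> //; first by rewrite invr_ge0 ltW.
  by rewrite Y'tr (le_trans shift).
by rewrite mulrA ler_pdivlMr // mulrC.
Qed.

(** Iterates the greedy step [T] times with the same [y]. An index may be chosen repeatedly, so the
    support has at most [T] elements. *)
Lemma barrier_greedy (y : J -> R) (u0 : R) (T : nat) :
  0 < u0 -> (forall j, 0 <= y j) ->
  exists w : J -> R, [/\ forall j, 0 <= w j,
    (#|[pred j | w j != 0%R]| <= T)%N,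
    psd ((u0 + T%:R)%:C%:M - \sum_j (w j)%:C *: (v j *m (v j)^h)) &
    T%:R * (\sum_j y j) <= (1 + d%:R / u0) * \sum_j y j * w j].
Proof.
move=> u0_gt0 y0; set phi := d%:R / u0.
(* The induction also carries strict definiteness and the bound on the potential; [phi] is its exact
   value at the initial barrier [u0]. *)
suff : exists w : J -> R,
    let Y := (u0 + T%:R)%:C%:M - \sum_j (w j)%:C *: (v j *m (v j)^h) in
    [/\ forall j, 0 <= w j, (#|[pred j | w j != 0%R]| <= T)%N,
    pd Y /\ \tr (invmx Y) <= phi%:C &
    T%:R * (\sum_j y j) <= (1 + phi) * \sum_j y j * w j].
  by move=> [w /= [w0 wT [/pd_psd ? _] ?]]; exists w.
elim: T => [|T [w /= [w0 wT [Ypd Ytr] wy]]].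
  exists (fun=> 0) => /=; split=> //.
  - by rewrite eq_card0 // => j; rewrite !inE eqxx.
  - rewrite addr0 big1 ?subr0 => [|j _]; last by rewrite scale0r.
    split; first exact: pd_scalar.
    rewrite invmx_scalar mxtrace_scalar -fmorphV -rmorphMn /=.
    by rewrite lecR /phi mulr_natl.
  - by rewrite mul0r big1 ?mulr0 // => j _; rewrite mulr0.
have [j [t [t0 Y'pd Y'tr jy]]] := barrier_greedy_step Ypd Ytr y0.
exists (fun i => w i + (if i == j then t else 0)) => /=.
have sumE (f : J -> R) : \sum_i f i * (if i == j then t else 0) = f j * t.
  by rewrite (bigD1 j) //= eqxx big1 ?addr0 // => i /negbTE->; rewrite mulr0.
set Y' := _ - _ in Y'pd Y'tr.
set Y'' := _ - _; have -> : Y'' = Y'.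
  rewrite /Y'' /Y'; under eq_bigr do rewrite rmorphD /= scalerDl.
  rewrite big_split /= (_ : \sum_i (if _ then _ else _)%:C *: _ =
      t%:C *: (v j *m (v j)^h)).
    by rewrite -natr1 addrA rmorphD rmorph1 raddfD /= opprD addrACA addrA.
  rewrite (bigD1 j) //= eqxx big1 ?addr0 // => i /negbTE->.
  by rewrite scale0r.
split=> //.
- by move=> i; rewrite addr_ge0 //; case: ifP.
- apply: (@leq_trans #|[predU1 j & [pred j | w j != 0%R]]|).
    apply/subset_leq_card/subsetP => i; rewrite !inE /=;
      have [//|_] := eqVneq i j.
    by rewrite addr0.
  by rewrite cardU1 addnC -addn1 leq_add // leq_b1.
- under [X in _ <= _ * X]eq_bigr do rewrite mulrDr.
  rewrite big_split /= sumE mulrDr -natr1 mulrDl mul1r.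
  exact: lerD.
Qed.

(** The admissible weights of the overview, with [m] for the support bound [d (k - 1)]. *)
Definition subframe (m : nat) (w : J -> R) : Prop :=
  [/\ forall j, 0 <= w j, (#|[pred j | w j != 0%R]| <= m)%N &
      psd (1%:M - \sum_j (w j)%:C *: (v j *m (v j)^h))].

Lemma subframe_heavy (m : nat) (y : J -> R) : (0 < m)%N ->
  (forall j, 0 <= y j) -> exists2 w, subframe (d * m) w &
  m%:R / (1 + Num.sqrt m%:R) ^+ 2 * (\sum_j y j) <= \sum_j y j * w j.
Proof.
move=> m_gt0 y0; set s := Num.sqrt _.
have s0 : 0 < s by rewrite sqrtr_gt0 ltr0n.
have sE : m%:R = s ^+ 2 by rewrite sqr_sqrtr ?ler0n.
have dR : 0 < d%:R :> R by rewrite ltr0n.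
(* After division by the final barrier the gain is [T / ((1 + d / u0) (u0 + T))]; for [T = d m] it
   is largest at [u0 = d s]. *)
have [w [w0 wm wpsd wy]] := @barrier_greedy y (d%:R * s) (d * m)
  (mulr_gt0 dR s0) y0.
pose c := d%:R * s * (1 + s).
have cE : d%:R * s + (d * m)%:R = c by rewrite /c natrM sE; ring.
have c0 : 0 < c by rewrite !mulr_gt0 ?addr_gt0.
exists (fun j => w j / c).
  split=> [j||]; first by rewrite divr_ge0 // ltW.
    by rewrite (eq_card (B := [pred j | w j != 0%R])) // => j;
      rewrite !inE mulf_eq0 invr_eq0 (gt_eqF c0) orbF.
  have := psdZ (_ : 0 <= c^-1%:C) wpsd; rewrite cE ler0c invr_ge0 ltW // =>
    /(_ isT).
  rewrite scalerBr scale_scalar_mx -rmorphM mulVf ?gt_eqF // rmorph1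
    scaler_sumr.
  by under eq_bigr do rewrite scalerA -rmorphM mulrC.
have -> : \sum_j y j * (w j / c) = (\sum_j y j * w j) / c.
  by rewrite mulr_suml; apply: eq_bigr => j _; rewrite mulrA.
rewrite ler_pdivlMr //.
set Z := \sum_j y j * w j in wy *; set X := \sum_j y j in wy *.
(* The factor [s / (1 + s)] is the inverse of [1 + d / u0]. *)
have := wy; rewrite -(ler_pM2l (_ : 0 < s / (1 + s))) ?divr_gt0 ?addr_gt0 //.
rewrite natrM sE /c.
have s1 : 1 + s != 0 by rewrite gt_eqF ?addr_gt0.
rewrite [leRHS](_ : _ = Z); last by field; rewrite s1 !gt_eqF.
apply: le_trans; rewrite le_eqVlt; apply/orP; left; apply/eqP; field.
by rewrite s1.
Qed.

(** Lowering weights shrinks the support and adds a positive semidefinite matrix to the defect. This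
    permits trimming an average that is too large. *)
Lemma subframe_le m (w w' : J -> R) : subframe m w ->
  (forall j, 0 <= w' j <= w j) -> subframe m w'.
Proof.
move=> [w0 wm wpsd] ww'; split=> [j||]; first by case/andP: (ww' j).
  apply: leq_trans wm; apply/subset_leq_card/subsetP => j; rewrite !inE.
  by apply: contraNneq => wj; have := ww' j; rewrite wj -eq_le eq_sym.
rewrite (_ : 1%:M - _ = (1%:M - \sum_j (w j)%:C *: (v j *m (v j)^h)) +
    \sum_j (w j - w' j)%:C *: (v j *m (v j)^h)).
  apply: psdD => //; apply: psd_sum => j _; apply: psdZ; last exact: psd_rank1.
  by rewrite ler0c subr_ge0; case/andP: (ww' j).
rewrite -addrA; congr (_ + _); rewrite -!sumrN -big_split /=.
by apply: eq_bigr => j _; rewrite rmorphB /= scalerBl addrA addNr add0r.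
Qed.

(** The trace of the identity bounds [w_j |v_j|^2] by [d]; summing the bounds [d / |v_j|^2] gives
    one constant for all indices. *)
Lemma subframe_bounded : exists b : R,
  forall m w, subframe m w -> forall j, w j <= b.
Proof.
pose a j : R := complex.Re (((v j)^h *m v j) 0 0).
have aE j : (a j)%:C = ((v j)^h *m v j) 0 0.
  by rewrite ge0_ReK ?ltW ?mxadj_self_gt0.
have a0 j : 0 < a j by rewrite -ltcR aE mxadj_self_gt0.
exists (\sum_j d%:R / a j) => m w [w0 _ wpsd] j.
apply: (@le_trans _ _ (d%:R / a j)); last first.
  by rewrite (bigD1 j) //= lerDl sumr_ge0 // => i _; rewrite divr_ge0 // ltW.
rewrite ler_pdivlMr // -lecR.
have := psd_trace_ge0 wpsd; rewrite linearB /= mxtrace1 subr_ge0 raddf_sum /=.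
have trE i : \tr ((w i)%:C *: (v i *m (v i)^h)) = (w i * a i)%:C.
  by rewrite linearZ /= -[v i *m _]mul1mx mxtrace_rank1 mulmx1 -aE -rmorphM.
rewrite (eq_bigr _ (fun i _ => trE i)) rmorph_nat; apply: le_trans.
by rewrite (bigD1 j) //= lerDl sumr_ge0 // => i _;
  rewrite ler0c mulr_ge0 // ltW.
Qed.

End Frame.
End Barrier.

(** * Averaging admissible weights *)

Section Minimax.
Variable R : realType.

Lemma pospart_sqrD (a x : R) :
  Num.max 0 (a + x) ^+ 2 <= Num.max 0 a ^+ 2 + 2 * (Num.max 0 a * x) + x ^+ 2.
Proof. by case: (leP 0 (a + x)) => ?; case: (leP 0 a) => ?; nra. Qed.

Variables (J : finType) (W : (J -> R) -> Prop) (q : R).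
Hypothesis W_heavy : forall y : J -> R, (forall j, 0 <= y j) ->
  exists2 w, W w & q * (\sum_j y j) <= \sum_j y j * w j.

(** Each new [w] answers the positive part [y] of the accumulated deficit. Heaviness makes the cross
    term nonpositive, so the squared norm of the positive part grows by at most [#|J| b] per
    round. *)
Lemma blackwell_approach (b : R) (T : nat) :
  (forall w, W w -> forall j, (q - w j) ^+ 2 <= b) ->
  exists2 ws : nat -> J -> R, forall t, W (ws t) &
  \sum_j Num.max 0 (\sum_(t < T) (q - ws t j)) ^+ 2 <= T%:R * (#|J|%:R * b).
Proof.
move=> Wb; elim: T => [|T [ws wsW IH]].
  have [w wW _] := W_heavy (fun=> lexx 0); exists (fun=> w) => //.
  by rewrite mul0r big1 // => j _; rewrite big_ord0 maxxx expr0n.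
pose y j := Num.max 0 (\sum_(t < T) (q - ws t j)).
have y0 j : 0 <= y j by rewrite le_max lexx.
have [w wW wy] := W_heavy y0.
exists (fun t => if (t < T)%N then ws t else w) => [t|]; first by case: ifP.
rewrite -natr1 mulrDl mul1r.
apply: (@le_trans _ _ (\sum_j (y j ^+ 2 + 2 * (y j * (q - w j)) + (q - w j) ^+
  2))).
  apply: ler_sum => j _; rewrite big_ord_recr /= ltnn.
  under eq_bigr => t _ do rewrite ltn_ord.
  exact: pospart_sqrD.
rewrite 2!big_split /= -addrA lerD //.
rewrite -[leRHS]add0r lerD //.
  rewrite -mulr_sumr pmulr_rle0 // (eq_bigr (fun j => q * y j - y j * w j)).
    by rewrite sumrB -mulr_sumr subr_le0.
  by move=> j _; rewrite mulrBr [y j * q]mulrC.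
rewrite mulr_natl -sumr_const; apply: ler_sum => j _; exact: Wb.
Qed.

Lemma uniform_average (b q' : R) :
  (forall w, W w -> forall j, 0 <= w j <= b) ->
  (forall w w', W w -> (forall j, 0 <= w' j <= w j) -> W w') ->
  0 <= q' < q ->
  exists (T : nat) (ws : 'I_T.+1 -> J -> R), (forall t, W (ws t)) /\
    forall j, \sum_t T.+1%:R^-1 * ws t j = q'.
Proof.
move=> Wb W_le /andP[q'0 q'q].
have Wsqr w : W w -> forall j, (q - w j) ^+ 2 <= (q + b) ^+ 2.
  by move=> wW j; have /andP[? ?] := Wb _ wW j; nra.
pose e := q - q'; have e0 : 0 < e by rewrite subr_gt0.
(* Large enough that the root of the Blackwell bound, of order [sqrt T], stays below the allowed
   deficit, linear in [T]. *)
pose T := Num.bound (#|J|%:R * (q + b) ^+ 2 / e ^+ 2).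
have TP : #|J|%:R * (q + b) ^+ 2 <= T.+1%:R * e ^+ 2.
  rewrite -ler_pdivrMr ?exprn_gt0 //; apply/ltW.
  apply: lt_le_trans (archi_boundP _) _;
    first by rewrite divr_ge0 ?sqr_ge0 // mulr_ge0 ?sqr_ge0 ?ler0n.
  by rewrite ler_nat.
have [ws wsW wsP] := @blackwell_approach _ T.+1 Wsqr.
have T0 : 0 < T.+1%:R :> R by rewrite ltr0Sn.
pose S j := \sum_(t < T.+1) ws t j.
have SP j : T.+1%:R * q' <= S j.
  have : Num.max 0 (\sum_(t < T.+1) (q - ws t j)) <= T.+1%:R * e.
    rewrite -(@ler_pXn2r _ 2) ?nnegrE ?le_max ?lexx ?mulr_ge0 // ?(ltW e0) //.
    apply: le_trans (_ : T.+1%:R * (#|J|%:R * (q + b) ^+ 2) <= _).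
      by apply: le_trans wsP; rewrite [leRHS](bigD1 j) //= lerDl sumr_ge0 // =>
        i _; rewrite sqr_ge0.
    by rewrite exprMn expr2 -!mulrA ler_pM2l.
  rewrite ge_max => /andP[_]; rewrite sumrB sumr_const card_ord -/(S j)
    -mulr_natl /e.
  by rewrite mulrBr lerBlDr addrAC lerBrDr => ?; lra.
(* Scaling coordinate [j] by [c j <= 1] turns the lower bound [q'] on the average into an
   equality. *)
pose c j := T.+1%:R * q' / S j.
have S0 j : 0 <= S j by apply: le_trans (SP j); rewrite mulr_ge0.
have c01 j : 0 <= c j <= 1.
  rewrite /c divr_ge0 ?mulr_ge0 ?ler0n //=; have [->|Sn] := eqVneq (S j) 0.
    by rewrite invr0 mulr0.
  by rewrite ler_pdivrMr ?mul1r // lt_neqAle eq_sym Sn S0.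
exists T, (fun t j => c j * ws t j); split=> [t|j].
  apply: W_le (wsW t) _ => j; have /andP[w0 _] := Wb _ (wsW t) j.
  by case/andP: (c01 j) => c0 c1; rewrite mulr_ge0 //= ler_piMl.
rewrite -mulr_sumr -mulr_sumr -/(S j) /c.
(* If [S j = 0] the average vanishes, and the lower bound on [S j] forces [q' = 0]. *)
have [SjE|Sn] := eqVneq (S j) 0; last by field; rewrite Sn gt_eqF.
have := SP j; rewrite SjE !mulr0 pmulr_rle0 // => ?.
by apply/eqP; rewrite eq_le q'0.
Qed.

End Minimax.

(** * Naimark dilation *)

Section Dilation.
Variable R : rcfType.
Local Notation C := (R[i]).

Lemma unitarymx_adjP m n (A : 'M[C]_(m, n)) :
  reflect (A *m A^h = 1%:M) (A \is unitarymx).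
Proof. by rewrite /mxadj map_trmx; exact: unitarymxP. Qed.

(** Spectral theorem: eigenvectors scaled by the square roots of their eigenvalues. Zero vectors may
    occur. *)
Lemma psd_rank1_decomposition d (A : 'M[C]_d) : psd A ->
  exists r : 'I_d -> 'cV[C]_d, A = \sum_i r i *m (r i)^h.
Proof.
move=> [hA pA].
have An : A \is normalmx.
  by apply/normalmxP; rewrite -map_trmx -/(mxadj A) hA.
pose P := spectralmx A; pose D := spectral_diag A.
have /unitarymx_adjP PP : P \is unitarymx := spectral_unitarymx A.
have AE : A = P^h *m diag_mx D *m P.
  rewrite {1}(orthomx_spectralP An) invmx_unitary -?map_trmx //.
  exact: spectral_unitarymx.
have D0 i : 0 <= D 0 i.
  have := pA (P^h *m delta_mx i 0).
  rewrite AE mxadjM mxadjK !mulmxA -(mulmxA _ P) PP mulmx1 -(mulmxA _ P) PP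
    mulmx1.
  by rewrite mx_diag_form mxE eqxx mulr1n.
exists (fun i => sqrtC (D 0 i) *: (row i P)^h).
rewrite {1}AE diag_mx_sum_delta mulmx_sumr mulmx_suml; apply: eq_bigr => i _.
rewrite mxadjZ mxadjK -scalemxAl -!scalemxAr -scalemxAl scalerA.
rewrite (CrealP _) ?ger0_real ?sqrtC_ge0 // -expr2 sqrtCK.
by rewrite -(mul_delta_mx (0 : 'I_1)) rowE mxadjM /mxadj map_delta_mx
  trmx_delta !mulmxA.
Qed.

Lemma isometry_complete m d (V : 'M[C]_(m, d)) : V^h *m V = 1%:M ->
  exists V' : 'M[C]_(m, m - d), [/\ V'^h *m V' = 1%:M, V^h *m V' = 0 &
    V *m V^h + V' *m V'^h = 1%:M].
Proof.
move=> VV; pose A := V^h.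
have Au : A \is unitarymx by apply/unitarymx_adjP; rewrite mxadjK.
have rA := mxrank_unitary Au.
have d_le : (d <= m)%N by rewrite -rA rank_leq_col.
pose Ao := orthomx Num.conj (mx_of_hermitian (hermitian1mx _)) A.
have := rank_ortho A; rewrite rA -/Ao => rAo.
(* Stated existentially so that the row count of the Gram-Schmidt basis of the orthogonal complement
   can be rewritten from [\rank Ao] to [m - d]. *)
have [B Bu AB] : exists2 B : 'M[C]_(m - d, m), B \is unitarymx & B *m A^h = 0.
  pose B := schmidt (row_base Ao).
  have Bu : B \is unitarymx by rewrite schmidt_unitarymx ?rank_leq_col.
  have BA : B *m A^h = 0.
    rewrite /mxadj map_trmx; apply/orthomx1P.
    by rewrite eqmx_schmidt_free ?row_base_free // eq_row_base.
  by move: B Bu BA; rewrite rAo => B; exists B.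
exists B^h; rewrite mxadjK.
have AB' : A *m B^h = 0 by rewrite -[LHS]mxadjK mxadjM mxadjK AB mxadj0.
have Bu' := unitarymx_adjP _ Bu.
split=> //.
have Wu : col_mx A B \is unitarymx.
  apply/unitarymx_adjP; rewrite /mxadj map_col_mx tr_col_mx mul_col_row.
  rewrite -!/(mxadj _) Bu' AB AB' mxadjK VV.
  by rewrite -scalar_mx_block.
have := mulmxKtV 1%:M Wu (subnKC d_le).
by rewrite mul1mx -map_trmx map_col_mx tr_col_mx mul_row_col -!/(mxadj _)
  mxadjK.
Qed.

(** [U] sends the range of [E] to that of [V] and an orthonormal basis of one complement to one of
    the other. *)
Lemma isometry_transport m d (E V : 'M[C]_(m, d)) :
  E^h *m E = 1%:M -> V^h *m V = 1%:M ->
  exists U : 'M[C]_m, [/\ U *m U^h = 1%:M, U^h *m U = 1%:M & U *m E = V].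
Proof.
move=> EE VV; have [E' [E'E' EE' E1]] := isometry_complete EE.
have [V' [V'V' VV' V1]] := isometry_complete VV.
have E'E : E'^h *m E = 0 by rewrite -[LHS]mxadjK mxadjM mxadjK EE' mxadj0.
pose U := V *m E^h + V' *m E'^h.
have UU : U *m U^h = 1%:M.
  rewrite /U mxadjD !mxadjM !mxadjK mulmxDl !mulmxDr -!mulmxA.
  rewrite !(mulmxA E^h) !(mulmxA E'^h) EE EE' E'E E'E'.
  by rewrite !mul0mx !mul1mx !mulmx0 addr0 add0r.
exists U; split=> //; first exact: mulmx1C.
by rewrite /U mulmxDl -!mulmxA EE E'E mulmx1 mulmx0 addr0.
Qed.

Lemma castmx_adj_mul m n n' (e : n = n') (A : 'M[C]_(m, n)) :
  (castmx (erefl m, e) A)^h *m castmx (erefl m, e) A = castmx (e, e) (A^h *m A).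
Proof. by case: _ / e; rewrite !castmx_id. Qed.

Lemma castmx1 n n' (e : n = n') : castmx (e, e) (1%:M : 'M[C]_n) = 1%:M.
Proof. by case: _ / e; rewrite castmx_id. Qed.

Lemma ancilla_embed_isometry d k (phi : 'cV[C]_k) : phi^h *m phi = 1%:M ->
  (ancilla_embed d phi)^h *m ancilla_embed d phi = 1%:M.
Proof.
move=> phi1; rewrite /ancilla_embed castmx_adj_mul.
rewrite [(_ *t _)^h]/mxadj map_mxT trmx_tens -!/(mxadj _) tensmx_mul phi1
  mxadj1 mulmx1.
suff -> : (1%:M : 'M[C]_d) *t (1%:M : 'M[C]_1) = 1%:M.
  exact: castmx1.
apply/matrixP => i j; case: (mxtens_indexP i) => i1 i2;
  case: (mxtens_indexP j) => j1 j2.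
rewrite tensmxE !mxE (can_eq (@mxtens_indexK _ _)) xpair_eqE.
by case: (i1 == j1); rewrite ?mul0r ?mul1r.
Qed.

(** The vectors of [s], as rows [x^*], form an isometry [V = U E] with [E] the ancilla embedding.
    Measuring the standard basis after [U] yields the effects [x x^*], and a deterministic
    post-processing merges equal labels. *)
Lemma naimark_dilation d k (I : finType) (i0 : I) (s : seq (I * 'cV[C]_d))
    (N : I -> 'M[C]_d) :
  (0 < k)%N -> (size s <= d * k)%N ->
  \sum_(x <- s) x.2 *m x.2^h = 1%:M ->
  (forall i, N i = \sum_(x <- s | x.1 == i) x.2 *m x.2^h) ->
  implementable k N.
Proof.
case: k => // k _ s_le s1 NE.
pose phi : 'cV[C]_k.+1 := delta_mx 0 0.
have phi1 : phi^h *m phi = 1%:M.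
  by rewrite /mxadj map_delta_mx trmx_delta mul_delta_mx; apply/matrixP => i j;
    rewrite !ord1 !mxE.
exists phi; split; first by rewrite phi1 mxE eqxx.
have EE := ancilla_embed_isometry d phi1.
set E := ancilla_embed d phi in EE *.
(* Pads [s] to length [d k] with zero vectors, which contribute nothing; [i0] gives the padded
   outcomes a label. *)
pose x0 := (i0, 0 : 'cV[C]_d).
pose g (l : 'I_(d * k.+1)) := nth x0 s l.
have sumg (Q : pred I) : \sum_(x <- s | Q x.1) x.2 *m x.2^h =
    \sum_l (Q (g l).1)%:R *: ((g l).2 *m (g l).2^h).
  rewrite (big_nth x0) big_mkord big_mkcond /=.
  pose F l := if Q (nth x0 s l).1 then (nth x0 s l).2 *m (nth x0 s l).2^h else
    0.
  rewrite (big_ord_widen_cond _ xpredT F s_le) {}/F.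
  rewrite big_mkcond /=; apply: eq_bigr => l _; rewrite /g.
  case: ltnP => [_|l_ge]; first by case: ifP; rewrite ?scale1r ?scale0r.
  by rewrite nth_default // mul0mx scaler0.
pose V : 'M[C]_(d * k.+1, d) := \matrix_l (g l).2^h.
have rowV l : row l V = (g l).2^h by rewrite rowK.
have VlV l : V^h *m delta_mx l l *m V = (g l).2 *m (g l).2^h.
  rewrite -(mul_delta_mx (0 : 'I_1)) mulmxA -mulmxA -rowE rowV; congr (_ *m _).
  rewrite -[RHS]mxadjK -rowV rowE mxadjM; congr (_ *m _).
  by rewrite /mxadj map_delta_mx trmx_delta.
have VV : V^h *m V = 1%:M.
  rewrite -[in LHS](mulmx1 V^h) mx1_sum_delta mulmx_sumr mulmx_suml -s1 (sumg
    xpredT).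
  by apply: eq_bigr => l _; rewrite VlV scale1r.
have [U [UU' U'U UE]] := isometry_transport EE VV.
exists (d * k.+1)%N, (fun l => U^h *m delta_mx l l *m U), (fun i l =>
  ((g l).1 == i)%:R).
split; last split.
- split; first split=> [l|].
  + apply: psd_conj; have := psd_rank1 (delta_mx l 0 : 'cV[C]_(d * k.+1)).
    by rewrite /mxadj map_delta_mx trmx_delta mul_delta_mx.
  + by rewrite -mulmx_suml -mulmx_sumr -mx1_sum_delta mulmx1.
  + move=> i j; rewrite -!mulmxA (mulmxA U) UU' mul1mx (mulmxA (delta_mx i i)).
    rewrite mul_delta_mx_cond; case: eqP => [->|_]; first by rewrite mulr1n.
    by rewrite mulr0n mul0mx mulmx0.
- split=> [i l|l]; first by rewrite ler0n.
  by rewrite (bigD1 (g l).1) //= eqxx big1 ?addr0 // => i /negbTE;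
    rewrite eq_sym => ->.
move=> i; rewrite NE (sumg (pred1 i)); apply: eq_bigr => l _.
rewrite rmorph_nat; congr (_ *: _).
by rewrite -VlV -UE mxadjM !mulmxA.
Qed.

End Dilation.

(** * Simulation *)

(** Splits each effect spectrally and discards the zero vectors, since the barrier step divides by
    quantities that vanish with [v]. *)
Lemma povm_rank1_refinement (R : rcfType) d n (M : 'I_n -> 'M[R[i]]_d) :
  is_POVM M -> exists (J : finType) (v : J -> 'cV[R[i]]_d) (f : J -> 'I_n),
  [/\ forall j, v j != 0, \sum_j v j *m (v j)^h = 1%:M &
      forall i, M i = \sum_(j | f j == i) v j *m (v j)^h].
Proof.
move=> [Mpsd M1].
have [r rP] := fin_all_exists (fun i => psd_rank1_decomposition (Mpsd i)).
pose A := [pred x : 'I_n * 'I_d | r x.1 x.2 != 0].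
pose J : finType := {x | x \in A}.
have ME i : M i = \sum_(j : J | (val j).1 == i)
    r (val j).1 (val j).2 *m (r (val j).1 (val j).2)^h.
  rewrite -(big_sub_cond A (fun x => x.1 == i) (fun x =>
    r x.1 x.2 *m (r x.1 x.2)^h)).
  transitivity (\sum_(a | a == i) \sum_b r a b *m (r a b)^h).
    by rewrite big_pred1_eq rP.
  rewrite pair_big_dep [LHS]big_mkcond [RHS]big_mkcond; apply: eq_bigr => x _.
  rewrite inE andbT andbC; case: (_ == i) => //=.
  by case: eqP => [->|//]; rewrite mul0mx.
exists J, (fun j => r (val j).1 (val j).2), (fun j => (val j).1); split=> //.
- by move=> j; have := valP j; rewrite inE.
- by rewrite -M1 (partition_big (fun j : J => (val j).1) xpredT) //;
    apply: eq_bigr => i _; rewrite ME.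
Qed.

Section Simulation.
Variables (R : realType) (d n : nat) (J : finType).
Variables (v : J -> 'cV[R[i]]_d) (f : J -> 'I_n).

Definition subframe_povm (w : J -> R) (o : option 'I_n) : 'M[R[i]]_d :=
  if o is Some i then \sum_(j | f j == i) (w j)%:C *: (v j *m (v j)^h)
  else 1%:M - \sum_j (w j)%:C *: (v j *m (v j)^h).

Lemma subframe_povm_implementable k (w : J -> R) : (0 < k)%N ->
  subframe v (d * k.-1) w ->
  is_POVM (subframe_povm w) /\ implementable k (subframe_povm w).
Proof.
move=> k0 [w0 wm wpsd]; have [r rE] := psd_rank1_decomposition wpsd.
pose S := [pred j | w j != 0].
(* At most [d (k - 1)] scaled frame vectors and [d] pieces of the defect, hence at most [d k] in
   all. *)
pose s := [seq (Some (f j), (Num.sqrt (w j))%:C *: v j) | j <- enum S] ++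
          [seq (None, r i) | i <- enum 'I_d].
have wE j : ((Num.sqrt (w j))%:C *: v j) *m ((Num.sqrt (w j))%:C *: v j)^h =
    (w j)%:C *: (v j *m (v j)^h).
  by rewrite mxadjZr -scalemxAl -scalemxAr scalerA -rmorphM -expr2 sqr_sqrtr.
have NE o : subframe_povm w o = \sum_(x <- s | x.1 == o) x.2 *m x.2^h.
  rewrite big_cat /= !big_map /=; case: o => [i|] /=.
    rewrite [X in _ = _ + X]big_pred0 ?addr0 // big_enum_cond /= (eq_bigr _
      (fun j _ => wE j)).
    rewrite [RHS](eq_bigl (fun j => (f j == i) && (j \in S)));
      last by move=> j; rewrite andbC.
    rewrite big_mkcondr /=; apply: eq_bigr => j _; rewrite inE /=.
    by case: eqP => [->|//]; rewrite scale0r.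
  by rewrite [X in _ = X + _]big_pred0 ?add0r // rE big_enum.
have s1 : \sum_(x <- s) x.2 *m x.2^h = 1%:M.
  rewrite big_cat /= !big_map /= !big_enum /= -rE (eq_bigr _ (fun j _ =>
    wE j)) big_mkcond /=.
  rewrite [X in X + _](_ : _ = \sum_j (w j)%:C *: (v j *m (v j)^h)).
    by rewrite addrC subrK.
  by apply: eq_bigr => j _; rewrite inE /=; case: eqP => [->|//];
    rewrite scale0r.
split; last first.
  apply: (naimark_dilation None k0 _ s1 NE).
  rewrite size_cat 2!size_map size_enum_ord -cardE
    -[k in (_ <= _ * k)%N](prednK k0) mulnS addnC.
  by rewrite leq_add2l.
split=> [o|]; first by rewrite NE; apply: psd_sum => x _; exact: psd_rank1.
by rewrite -s1 (partition_big fst xpredT) //; apply: eq_bigr => o _; rewrite NE.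
Qed.

(** A nonzero effect is either the failure outcome or carries the label of some index in the
    support. *)
Lemma card_subframe_povm m (w : J -> R) : subframe v m w ->
  (#|[pred o | subframe_povm w o != 0%R]| <= m.+1)%N.
Proof.
move=> [_ wm _]; pose s := None :: [seq Some (f j) | j in [pred j |
  w j != 0%R]].
apply: (@leq_trans (size s)); last by rewrite /= size_image.
apply: leq_trans (card_size s); apply/subset_leq_card/subsetP => -[i|];
  rewrite !inE //=.
apply: contraNT => iS; rewrite big1 // => j /eqP ji.
suff /eqP -> : w j == 0 by rewrite scale0r.
by apply: contraNT iS => wj; rewrite -ji; apply/imageP; exists j.
Qed.

Lemma subframe_simulation (M : 'I_n -> 'M[R[i]]_d) (k : nat) (q : R) :
  (0 < d)%N -> (1 < k)%N -> (forall j, v j != 0) ->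
  \sum_j v j *m (v j)^h = 1%:M ->
  (forall i, M i = \sum_(j | f j == i) v j *m (v j)^h) ->
  0 <= q < k.-1%:R / (1 + Num.sqrt k.-1%:R) ^+ 2 ->
  exists (B : finType) (p : B -> R) (N : B -> option 'I_n -> 'M[R[i]]_d),
    convex_ancilla_simulation k M p N q /\
    forall b : B, (#|[pred o | N b o != 0%R]| <= (d * k.-1).+1)%N.
Proof.
move=> d0 k1 v0 v1 ME q_lt.
have k1' : (0 < k.-1)%N by rewrite -ltnS prednK // ltnW.
have [b wb] := subframe_bounded v0.
have [T [ws [wsF wsq]]] := uniform_average
  (fun y y0 => subframe_heavy d0 v0 v1 k1' y0)
  (fun w wF j => introT andP (conj (let: And3 w0 _ _ := wF in w0 j)
    (wb _ w wF j)))
  (@subframe_le _ _ _ v _) q_lt.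
exists 'I_T.+1, (fun=> T.+1%:R^-1), (fun t => subframe_povm (ws t)).
split=> [|t]; last exact: card_subframe_povm.
(* A general [P] serves both a single outcome and, with all indices, the failure outcome. *)
have mixE (P : pred J) : \sum_(t < T.+1) (T.+1%:R^-1)%:C *:
    (\sum_(j | P j) (ws t j)%:C *: (v j *m (v j)^h)) =
    q%:C *: \sum_(j | P j) v j *m (v j)^h.
  under eq_bigr do rewrite scaler_sumr.
  rewrite exchange_big scaler_sumr; apply: eq_bigr => j _ /=.
  rewrite -(wsq j) rmorph_sum /= scaler_suml; apply: eq_bigr => t _.
  by rewrite scalerA -rmorphM.
have p1 : \sum_(t < T.+1) (T.+1%:R^-1 : R) = 1.
  by rewrite sumr_const card_ord -[LHS]mulr_natl divff ?pnatr_eq0.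
split; first by split=> // _; rewrite invr_ge0 ler0n.
split; first by move=> t; apply: subframe_povm_implementable;
  rewrite ?(ltnW k1).
split=> [i|] /=; first by rewrite mixE ME.
under eq_bigr do rewrite scalerBr.
rewrite sumrB mixE v1 -scaler_suml -rmorph_sum /= p1 rmorphB /=.
by rewrite scalerBl.
Qed.

End Simulation.

Theorem theorem5 (R : realType) :
  (exists K : R, 0 < K /\
    forall (d k n : nat) (M : 'I_n -> 'M[R[i]]_d),
      (1 <= d)%N -> (2 <= k)%N -> is_POVM M ->
      exists (B : finType) (p : B -> R) (N : B -> option 'I_n -> 'M[R[i]]_d) (q : R),
        convex_ancilla_simulation k M p N q /\
        1 - K / Num.sqrt (k%:R) <= q)
  /\
  (forall (d n : nat) (M : 'I_n -> 'M[R[i]]_d),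
      (1 <= d)%N -> is_POVM M ->
      exists (B : finType) (p : B -> R) (N : B -> option 'I_n -> 'M[R[i]]_d) (q : R),
        convex_ancilla_simulation 2 M p N q /\
        1 / 8 <= q /\
        forall b : B, (#|[pred o | N b o != 0%R]| <= d.+1)%N).
Proof.
split.
  exists 4; split=> // d k n M d0 k1 /povm_rank1_refinement[J [v [f [v0 v1
    ME]]]].
  (* The maximum with 0 covers small [k], where [1 - 4 / sqrt k] is negative. *)
  pose q : R := Num.max 0 (1 - 4 / Num.sqrt k%:R).
  have q_lt : 0 <= q < k.-1%:R / (1 + Num.sqrt k.-1%:R) ^+ 2.
    rewrite le_max lexx /=; set s := Num.sqrt k.-1%:R;
      set r := Num.sqrt _ in q *.
    have s0 : 0 < s by rewrite sqrtr_gt0 ltr0n -ltnS prednK // ltnW.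
    have sE : s ^+ 2 = k.-1%:R by rewrite sqr_sqrtr ?ler0n.
    have r0 : 0 < r by rewrite sqrtr_gt0 ltr0n ltnW.
    have rE : r ^+ 2 = s ^+ 2 + 1.
      by rewrite sE sqr_sqrtr ?ler0n // natr1 prednK // ltnW.
    have rs : r <= s + 1 by nra.
    have s1 : 0 < (1 + s) ^+ 2 by rewrite exprn_gt0 ?addr_gt0.
    rewrite -sE gt_max divr_gt0 ?exprn_gt0 ?addr_gt0 //= ltr_pdivlMr //.
    (* What remains amounts to [r (1 + 2 s) < 4 (1 + s)^2], which follows from [r <= s + 1]. *)
    rewrite -(ltr_pM2r r0) mulrAC mulrBl divfK ?gt_eqF // mul1r.
    nra.
  have [B [p [N [simN _]]]] := subframe_simulation d0 k1 v0 v1 ME q_lt.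
  by exists B, p, N, q; split=> //; rewrite le_max lexx orbT.
move=> d n M d0 /povm_rank1_refinement[J [v [f [v0 v1 ME]]]].
(* For [k = 2] the threshold is [1/4]; averaging reaches every value strictly below it, in
   particular [1/8]. *)
have q_lt : 0 <= (1 / 8 : R) < 2.-1%:R / (1 + Num.sqrt 2.-1%:R) ^+ 2.
  rewrite /= sqrtr1 divr_ge0 //= ltr_pdivlMr ?exprn_gt0 //; lra.
have [B [p [N [simN cardN]]]] := subframe_simulation d0 (ltnSn 1) v0 v1 ME q_lt.
by exists B, p, N, (1 / 8); split=> //; split=> // b; have := cardN b;
  rewrite muln1.
Qed.
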